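(* $\mathrm{Proj}_{dr,pr,nr}(InitSP)=\mathrm{Proj}_{dr,pr,nr}(SP)$; that is, the (feasible sets of the) models $InitSP$ and $SP$ admit the same set of first-stage decisions $(dr,pr,nr)$.
   Context: Data: $N$ is a finite set of zones, $CNE$ a finite set of critical network elements, $RDB$ a finite set of reserve demand bids, $G$ a finite set of generators. Each bid $r\in RDB$ and each generator $g\in G$ is located in a zone $z(r)\in N$, $z(g)\in N$. Real parameters: $DR_r$ ($r\in RDB$), $\widetilde P_g$ ($g\in G$), $PTDF_{k,z}$ ($k\in CNE,z\in N$), $\widetilde F_k$ ($k\in CNE$). Both models maximize the same objective $\sum_r VR^r dr_r$ (with real parameters $VR^r$). $InitSP$: the feasible set consists of first-stage variables $dr=(dr_r)_{r\in RDB}$, $pr=(pr_g)_{g\in G}$, $nr=(nr_z)_{z\in N}$ and, for each scenario $s=(s_r)_{r\in RDB}\in[0,1]^{RDB}$, second-stage variables $(drAct_{r,s})_r,(prAct_{g,s})_g,(nrAct_{z,s})_z$ such that $dr_r\le DR_r$ for all $r$; $pr_g\le\widetilde P_g$ for all $g$; $\sum_{r:z(r)=z}dr_r-\sum_{g:z(g)=z}pr_g=-nr_z$ for all $z\in N$; $\sum_z nr_z=0$; and for every $s\in[0,1]^{RDB}$: $drAct_{r,s}=s_r\,dr_r$ for all $r$; $prAct_{g,s}\le pr_g$ for all $g$; $\sum_{r:z(r)=z}drAct_{r,s}-\sum_{g:z(g)=z}prAct_{g,s}+nrAct_{z,s}=0$ for all $z$; $\sum_z nrAct_{z,s}=0$;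 $\sum_z PTDF_{k,z}\,nrAct_{z,s}\le\widetilde F_k$ for all $k\in CNE$; and $dr,pr,drAct,prAct\ge0$. $SP$: the feasible set consists of $(dr,pr,nr)$ such that $dr_r\le DR_r$ for all $r$; $pr_g\le\widetilde P_g$ for all $g$; $\sum_{r:z(r)=z}dr_r-\sum_{g:z(g)=z}pr_g=-nr_z$ for all $z$; $dr,pr\ge0$; and $nr\in\mathrm{Proj}_{nr}(XSP)$. $XSP$ is the set of all tuples consisting of first-stage variables $(nr_z,TRD_z,TRS_z)_{z\in N}$ and, for each scenario $s=(s_z)_{z\in N}\in\{0,1\}^{N}$, second-stage variables $(TRDAct_{z,s},TRSAct_{z,s},nrAct_{z,s})_{z\in N}$, all real, such that: $\sum_{z} nr_z=0$; $\sum_{z} PTDF_{k,z}\,nr_z\le \widetilde F_k$ for all $k\in CNE$; $nr_z=TRS_z-TRD_z$ for all $z$; and for every $s\in\{0,1\}^N$: $TRDAct_{z,s}=s_z\,TRD_z$, $TRSAct_{z,s}\le TRS_z$, $nrAct_{z,s}=TRSAct_{z,s}-TRDAct_{z,s}$ for all $z$; $\sum_z nrAct_{z,s}=0$; $\sum_z PTDF_{k,z}\,nrAct_{z,s}\le \widetilde F_k$ for all $k\in CNE$; and $TRS,TRD,TRSAct,TRDAct\ge 0$. $\mathrm{Proj}$ with variable names as subscript denotes projection on those variables. *)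

(* Defs.v *)
From mathcomp Require Import all_boot all_order all_algebra.
From mathcomp Require Import boolp classical_sets reals.

Set Implicit Arguments.
Unset Strict Implicit.
Unset Printing Implicit Defensive.

Import Order.TTheory GRing.Theory Num.Theory.
Local Open Scope classical_set_scope.
Local Open Scope ring_scope.

(* [N] = zones, [CNE] = critical network elements, [RDB] = reserve demand
   bids, [G] = generators. *)
Record market_data (R : realType) (N CNE RDB G : finType) := MarketData {
  bid_zone : RDB -> N;
  gen_zone : G -> N;
  DR : RDB -> R;
  Ptilde : G -> R;
  PTDF : CNE -> N -> R;
  Ftilde : CNE -> R
}.

Record first_stage (R : realType) (N RDB G : finType) := FirstStage {
  dr : RDB -> R;
  pr : G -> R;
  nr : N -> R
}.

Record unit_scenario (R : realType) (RDB : finType) := UnitScenario {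
  scenario_val :> RDB -> R;
  scenario_range : forall r : RDB, 0 <= scenario_val r <= 1
}.

Record init_second_stage (R : realType) (N RDB G : finType) :=
  InitSecondStage {
    init_drAct : RDB -> unit_scenario R RDB -> R;
    init_prAct : G -> unit_scenario R RDB -> R;
    init_nrAct : N -> unit_scenario R RDB -> R
}.

Record InitSP_feasible (R : realType) (N CNE RDB G : finType)
    (d : market_data R N CNE RDB G)
    (x : first_stage R N RDB G) (y : init_second_stage R N RDB G) : Prop :=
  InitSPFeasible {
    InitSP_dr_le : forall r, dr x r <= DR d r;
    InitSP_pr_le : forall g, pr x g <= Ptilde d g;
    InitSP_balance : forall z,
      \sum_(r | bid_zone d r == z) dr x r
        - \sum_(g | gen_zone d g == z) pr x g = - nr x z;
    InitSP_nr_sum : \sum_z nr x z = 0;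
    InitSP_drAct : forall s r, init_drAct y r s = s r * dr x r;
    InitSP_prAct_le : forall s g, init_prAct y g s <= pr x g;
    InitSP_act_balance : forall s z,
      \sum_(r | bid_zone d r == z) init_drAct y r s
        - \sum_(g | gen_zone d g == z) init_prAct y g s
        + init_nrAct y z s = 0;
    InitSP_nrAct_sum : forall s, \sum_z init_nrAct y z s = 0;
    InitSP_act_flow : forall s k,
      \sum_z PTDF d k z * init_nrAct y z s <= Ftilde d k;
    InitSP_dr_ge0 : forall r, 0 <= dr x r;
    InitSP_pr_ge0 : forall g, 0 <= pr x g;
    InitSP_drAct_ge0 : forall s r, 0 <= init_drAct y r s;
    InitSP_prAct_ge0 : forall s g, 0 <= init_prAct y g s
}.

Definition InitSP (R : realType) (N CNE RDB G : finType)
    (d : market_data R N CNE RDB G) :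
    set (first_stage R N RDB G * init_second_stage R N RDB G) :=
  [set xy | InitSP_feasible d xy.1 xy.2].

(* A scenario in {0,1}^N is a map [s : N -> bool]; its entry at [z], as a real
   number, is [(s z)%:R]. *)
Record XSP_point (R : realType) (N : finType) := XSPPoint {
  XSP_nr : N -> R;
  TRD : N -> R;
  TRS : N -> R;
  TRDAct : N -> (N -> bool) -> R;
  TRSAct : N -> (N -> bool) -> R;
  XSP_nrAct : N -> (N -> bool) -> R
}.

Record XSP_feasible (R : realType) (N CNE RDB G : finType)
    (d : market_data R N CNE RDB G) (x : XSP_point R N) : Prop :=
  XSPFeasible {
    XSP_nr_sum : \sum_z XSP_nr x z = 0;
    XSP_flow : forall k, \sum_z PTDF d k z * XSP_nr x z <= Ftilde d k;
    XSP_nrE : forall z, XSP_nr x z = TRS x z - TRD x z;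
    XSP_TRDAct : forall s z, TRDAct x z s = (s z)%:R * TRD x z;
    XSP_TRSAct_le : forall s z, TRSAct x z s <= TRS x z;
    XSP_nrActE : forall s z, XSP_nrAct x z s = TRSAct x z s - TRDAct x z s;
    XSP_nrAct_sum : forall s, \sum_z XSP_nrAct x z s = 0;
    XSP_act_flow : forall s k,
      \sum_z PTDF d k z * XSP_nrAct x z s <= Ftilde d k;
    XSP_TRS_ge0 : forall z, 0 <= TRS x z;
    XSP_TRD_ge0 : forall z, 0 <= TRD x z;
    XSP_TRSAct_ge0 : forall s z, 0 <= TRSAct x z s;
    XSP_TRDAct_ge0 : forall s z, 0 <= TRDAct x z s
}.

Definition XSP (R : realType) (N CNE RDB G : finType)
    (d : market_data R N CNE RDB G) : set (XSP_point R N) :=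
  [set x | XSP_feasible d x].

Record SP_feasible (R : realType) (N CNE RDB G : finType)
    (d : market_data R N CNE RDB G) (x : first_stage R N RDB G) : Prop :=
  SPFeasible {
    SP_dr_le : forall r, dr x r <= DR d r;
    SP_pr_le : forall g, pr x g <= Ptilde d g;
    SP_balance : forall z,
      \sum_(r | bid_zone d r == z) dr x r
        - \sum_(g | gen_zone d g == z) pr x g = - nr x z;
    SP_dr_ge0 : forall r, 0 <= dr x r;
    SP_pr_ge0 : forall g, 0 <= pr x g;
    SP_nr_proj : [set XSP_nr w | w in XSP d] (nr x)
}.

(* The variables of SP are exactly (dr, pr, nr), so this set is its own
   projection on (dr, pr, nr). *)
Definition SP (R : realType) (N CNE RDB G : finType)
    (d : market_data R N CNE RDB G) : set (first_stage R N RDB G) :=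
  [set x | SP_feasible d x].

(* Main.v *)
Require Import Defs.
From mathcomp Require Import all_boot all_order all_algebra.
From mathcomp Require Import boolp classical_sets reals.
From mathcomp Require Import ring lra.

(** Write [D z] and [S z] for the demand bids and the generation procured in
    zone [z], so that [nr z = S z - D z].

    A solution of InitSP yields a point of XSP by aggregation over zones, with
    [TRD = D] and [TRS = S]: the 0/1 scenario [s] on zones is read as the bid
    scenario activating every bid of the zones selected by [s].  The network
    limits on [nr] itself, which InitSP does not impose, come from full
    activation: the total of the activated generation must then match the total
    demand, which is the total of the procured generation, so all generation is
    activated and [nrAct = nr] ([eq_of_le_sum]).

    Conversely, fix a bid scenario and let [d z], between [0] and [D z], be the
    demand it activates.  Some [v] in the convex set [V] of balanced net
    positions within the network limits must satisfy [- d z <= v z <= S z - d z]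
    for all [z]; the activated generation [v z + d z] is then spread
    over the generators of [z] in proportion to [pr].  The point of XSP may have
    [TRD] and [TRS] quite different from [D] and [S], but they have the same
    difference, and the 0/1 scenario [s] of XSP therefore provides a [v] in [V]
    which satisfies one of the two bounds in each zone: where [s z] is false,
    [v z = TRSAct z s >= 0 >= - d z]; where [s z] is true,
    [v z <= TRS z - TRD z = S z - D z <= S z - d z].  As every pattern of
    one-sided bounds occurs, convexity produces a [v] that
    satisfies all the bounds ([convex_box_meet]): the zones are treated one by
    one, crossing each from one side of its interval to the other along a
    segment. *)

Set Implicit Arguments.
Unset Strict Implicit.
Unset Printing Implicit Defensive.

Import Order.TTheory GRing.Theory Num.Theory.
Local Open Scope classical_set_scope.
Local Open Scope ring_scope.

Lemma segment_meets_itv (R : realType) (lo hi a b : R) :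
  lo <= hi -> lo <= a -> b <= hi ->
  exists t, 0 <= t <= 1 /\ lo <= t * a + (1 - t) * b <= hi.
Proof.
move=> lohi loa bhi.
have [ahi|hia] := leP a hi.
  by exists 1; rewrite subrr mul0r addr0 mul1r ler01 lexx loa ahi.
have ab0 : 0 < a - b by lra.
(* The parameter at which the segment from [b] to [a] reaches [hi]. *)
exists ((hi - b) / (a - b)); split.
  by rewrite divr_ge0 ?(ltW ab0) ?subr_ge0 //= ler_pdivrMr // mul1r lerB // ltW.
suff -> : (hi - b) / (a - b) * a + (1 - (hi - b) / (a - b)) * b = hi.
  by rewrite lohi lexx.
by field; rewrite gt_eqF.
Qed.

(** The zones [z] in [r] already meet both bounds; to add a zone [z0], join the
    points obtained for the two values of [s z0].  The constraints on the other
    zones agree for these two points and define a convex set, so the point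
    of the segment that lies between [lo z0] and [hi z0] still satisfies them. *)
Lemma convex_box_meet (R : realType) (N : finType) (V : set (N -> R))
    (lo hi : N -> R) :
  (forall t u v, 0 <= t <= 1 -> V u -> V v ->
    V (fun z => t * u z + (1 - t) * v z)) ->
  (forall z, lo z <= hi z) ->
  (forall s : N -> bool, exists2 v, V v &
    forall z, if s z then v z <= hi z else lo z <= v z) ->
  exists2 v, V v & forall z, lo z <= v z <= hi z.
Proof.
move=> Vconv lohi Vside.
have key (r : seq N) (s : N -> bool) : exists2 v, V v & forall z,
    if z \in r then lo z <= v z <= hi z
    else if s z then v z <= hi z else lo z <= v z.
  elim: r s => [|z0 r IHr] s; first exact: Vside.
  have [u Vu uP] := IHr (fun z => if z == z0 then false else s z).
  have [v Vv vP] := IHr (fun z => if z == z0 then true else s z).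
  have [z0r|z0r] := boolP (z0 \in r).
    exists u => // z; have := uP z; rewrite in_cons.
    by case: eqP => [->|_] //=; rewrite z0r.
  have := uP z0; have := vP z0; rewrite eqxx (negPf z0r) => vz0 uz0.
  have [t [t01 tP]] := @segment_meets_itv _ _ _ _ _ (lohi z0) uz0 vz0.
  exists (fun z => t * u z + (1 - t) * v z); first exact: Vconv.
  move=> z; rewrite in_cons; have [->//|zz0] := eqVneq z z0.
  rewrite /=; have := uP z; have := vP z; rewrite (negPf zz0).
  have /andP[t0 t1] := t01; clear - t0 t1.
  by case: ifP => _; [move=> /andP[? ?] /andP[? ?]; apply/andP; split; nra
                     | case: ifP => _ ? ?; nra].
have [v Vv vP] := key (enum N) (fun=> true).
by exists v => // z; have := vP z; rewrite mem_enum.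
Qed.

Lemma eq_of_le_sum (R : realType) (I : finType) (f g : I -> R) :
  (forall i, f i <= g i) -> \sum_i f i = \sum_i g i -> forall i, f i = g i.
Proof.
move=> fg sumfg i; apply/esym/eqP; rewrite -subr_eq0; apply/eqP.
have : \sum_i (g i - f i) = 0 by rewrite sumrB sumfg subrr.
move=> /eqP; rewrite psumr_eq0 => [/allP/(_ i)|j _]; last by rewrite subr_ge0.
by rewrite mem_index_enum => /(_ isT)/eqP.
Qed.

(** A zonal amount becomes generator amounts: one common fraction of the
    capacities keeps every generator within its own bounds as soon as the total
    fits. *)
Lemma proportional_share (R : realType) (I : finType) (P : pred I)
    (p : I -> R) (q : R) :
  (forall i, 0 <= p i) -> 0 <= q <= \sum_(i | P i) p i ->
  let c := q / \sum_(i | P i) p i in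
  0 <= c <= 1 /\ \sum_(i | P i) p i * c = q.
Proof.
move=> p0 /andP[q0 qp] /=; rewrite -mulr_suml.
have [S0|S0] := eqVneq (\sum_(i | P i) p i) 0.
  (* Division by zero gives the fraction [0], which is right since [q = 0]. *)
  rewrite S0 invr0 mulr0 lexx ler01; split=> //; rewrite mul0r.
  by apply/eqP; rewrite eq_le q0 -S0 qp.
have Sgt0 : 0 < \sum_(i | P i) p i by rewrite lt_def S0 sumr_ge0.
by rewrite divr_ge0 ?(ltW Sgt0)//= ler_pdivrMr // mul1r qp mulrC divfK.
Qed.

Definition network_region (R : realType) (N CNE RDB G : finType)
    (d : market_data R N CNE RDB G) : set (N -> R) :=
  [set v | \sum_z v z = 0 /\ forall k, \sum_z PTDF d k z * v z <= Ftilde d k].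

Lemma network_region_convex (R : realType) (N CNE RDB G : finType)
    (d : market_data R N CNE RDB G) (t : R) (u v : N -> R) :
  0 <= t <= 1 -> network_region d u -> network_region d v ->
  network_region d (fun z => t * u z + (1 - t) * v z).
Proof.
move=> /andP[t0 t1] [u0 uF] [v0 vF]; split=> [|k].
  by rewrite big_split /= -!mulr_sumr u0 v0 !mulr0 addr0.
under eq_bigr do rewrite mulrDr (mulrCA _ t) (mulrCA _ (1 - t)).
rewrite big_split /= -!mulr_sumr.
have := uF k; have := vF k.
set a := \sum_z _; set b := \sum_z _; clear - t0 t1 => ? ?; nra.
Qed.

Definition all_bids_of (R : realType) (N RDB : finType) (zone : RDB -> N)
  (s : N -> bool) : unit_scenario R RDB.
Proof.
exists (fun r => (s (zone r))%:R) => r.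
by case: (s _); rewrite lexx ler01.
Defined.

(** Zonal totals of the InitSP variables form a point of XSP; only the network
    limits on [nr] need an argument, which is the full activation scenario. *)
Lemma InitSP_sub_SP (R : realType) (N CNE RDB G : finType)
    (d : market_data R N CNE RDB G) x y :
  InitSP_feasible d x y -> SP_feasible d x.
Proof.
move=> F.
pose D z := \sum_(r | bid_zone d r == z) dr x r.
pose S z := \sum_(g | gen_zone d g == z) pr x g.
pose sc (s : N -> bool) : unit_scenario R RDB :=
  all_bids_of R (bid_zone d) s.
pose SA z s := \sum_(g | gen_zone d g == z) init_prAct y g (sc s).
have nrE z : nr x z = S z - D z.
  by have := InitSP_balance F z; rewrite -/(D z) -/(S z) => E; lra.
have SA_le s z : SA z s <= S z.
  by apply: ler_sum => g _; exact: (InitSP_prAct_le F).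
have nrActE s z : init_nrAct y z (sc s) = SA z s - (s z)%:R * D z.
  have := InitSP_act_balance F (sc s) z; rewrite -/(SA z s).
  suff -> : \sum_(r | bid_zone d r == z) init_drAct y r (sc s)
            = (s z)%:R * D z by move=> E; lra.
  rewrite mulr_sumr; apply: eq_bigr => r /eqP <-.
  exact: (InitSP_drAct F).
(* All demand is activated here and both net positions sum to zero over the
   zones, so no procured generation can stay idle. *)
have full_nr z : init_nrAct y z (sc (fun=> true)) = nr x z.
  move: z; apply: eq_of_le_sum => [z|].
    by rewrite nrActE nrE mul1r lerD2r SA_le.
  by rewrite (InitSP_nrAct_sum F) (InitSP_nr_sum F).
have D0 z : 0 <= D z by apply: sumr_ge0 => r _; exact: (InitSP_dr_ge0 F).
have S0 z : 0 <= S z by apply: sumr_ge0 => g _; exact: (InitSP_pr_ge0 F).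
split; try by case: F.
exists (XSPPoint (nr x) D S (fun z s => (s z)%:R * D z) SA
         (fun z s => init_nrAct y z (sc s))) => //.
split=> //=.
- exact: (InitSP_nr_sum F).
- move=> k; under eq_bigr do rewrite -full_nr.
  exact: (InitSP_act_flow F).
- by move=> s; exact: (InitSP_nrAct_sum F).
- by move=> s k; exact: (InitSP_act_flow F).
- by move=> s z; apply: sumr_ge0 => g _; exact: (InitSP_prAct_ge0 F).
- by move=> s z; rewrite mulr_ge0.
Qed.

(** This is where zonal 0/1 scenarios are shown to cover the fractional bid
    scenarios: the responses of XSP to the former give the one-sided bounds that
    [convex_box_meet] turns into the two-sided ones. *)
Lemma SP_network_response (R : realType) (N CNE RDB G : finType)
    (d : market_data R N CNE RDB G) x (s : unit_scenario R RDB) :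
  SP_feasible d x ->
  exists2 v, network_region d v & forall z,
    0 <= v z + \sum_(r | bid_zone d r == z) s r * dr x r
      <= \sum_(g | gen_zone d g == z) pr x g.
Proof.
move=> F; have [w wF nrE] := SP_nr_proj F.
pose D z := \sum_(r | bid_zone d r == z) dr x r.
pose S z := \sum_(g | gen_zone d g == z) pr x g.
pose e z := \sum_(r | bid_zone d r == z) s r * dr x r.
have e0 z : 0 <= e z.
  apply: sumr_ge0 => r _; rewrite mulr_ge0 ?(SP_dr_ge0 F) //.
  by have /andP[] := scenario_range s r.
have eD z : e z <= D z.
  apply: ler_sum => r _; rewrite ler_piMl ?(SP_dr_ge0 F) //.
  by have /andP[] := scenario_range s r.
have S0 z : 0 <= S z by apply: sumr_ge0 => g _; exact: (SP_pr_ge0 F).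
(* The XSP point determines the procured amounts only up to a common shift of
   supply and demand in each zone. *)
have TE z : TRS w z - TRD w z = S z - D z.
  have := SP_balance F z; rewrite -/(D z) -/(S z) -nrE (XSP_nrE wF) => E.
  by lra.
have [v Vv vP] : exists2 v, network_region d v &
    forall z, - e z <= v z <= S z - e z.
  apply: convex_box_meet => [t u v||b]; first exact: network_region_convex.
    by move=> z; have := S0 z => ?; lra.
  (* The bound obtained is the upper one exactly in the zones activated by [b]:
     there it is [TE] that bounds [TRS z - TRD z] by [S z - e z]. *)
  exists (fun z => XSP_nrAct w z b).
    split; first exact: (XSP_nrAct_sum wF).
    by move=> k; exact: (XSP_act_flow wF).
  move=> z; rewrite (XSP_nrActE wF) (XSP_TRDAct wF).
  have := XSP_TRSAct_le wF b z; have := XSP_TRSAct_ge0 wF b z.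
  have := TE z; have := eD z; have := e0 z.
  by case: (b z); rewrite ?mul1r ?mul0r => ? ? ? ? ?; lra.
exists v => // z; have /andP[? ?] := vP z.
by rewrite -/(e z) -/(S z); apply/andP; split; lra.
Qed.

Lemma SP_sub_InitSP (R : realType) (N CNE RDB G : finType)
    (d : market_data R N CNE RDB G) x :
  SP_feasible d x -> exists y, InitSP_feasible d x y.
Proof.
move=> F; have [w wF nrE] := SP_nr_proj F.
have resp (s : unit_scenario R RDB) : exists v, network_region d v /\
    forall z, 0 <= v z + \sum_(r | bid_zone d r == z) s r * dr x r
                <= \sum_(g | gen_zone d g == z) pr x g.
  by have [v Vv vP] := SP_network_response s F; exists v.
have [v vP] := choice resp.
pose q s z := v s z + \sum_(r | bid_zone d r == z) s r * dr x r.
pose c s z := q s z / \sum_(g | gen_zone d g == z) pr x g.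
have cP s z : 0 <= c s z <= 1 /\
    \sum_(g | gen_zone d g == z) pr x g * c s z = q s z.
  apply: proportional_share; first exact: (SP_pr_ge0 F).
  by have [_] := vP s; exact.
exists (InitSecondStage (fun r s => s r * dr x r)
         (fun g s => pr x g * c s (gen_zone d g)) (fun z s => v s z)).
split=> //=; try by case: F.
- by rewrite -nrE; exact: (XSP_nr_sum wF).
- move=> s g; have [/andP[_ c1] _] := cP s (gen_zone d g).
  by rewrite ler_piMr // (SP_pr_ge0 F).
- move=> s z; have [_ cE] := cP s z.
  have -> : \sum_(g | gen_zone d g == z) pr x g * c s (gen_zone d g) = q s z.
    by rewrite -cE; apply: eq_bigr => g /eqP ->.
  by rewrite /q; ring.
- by move=> s; have [[]] := vP s.
- by move=> s k; have [[_]] := vP s.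
- move=> s r; rewrite mulr_ge0 ?(SP_dr_ge0 F) //.
  by have /andP[] := scenario_range s r.
- move=> s g; have [/andP[c0 _] _] := cP s (gen_zone d g).
  by rewrite mulr_ge0 // (SP_pr_ge0 F).
Qed.

Theorem proposition2 (R : realType) (N CNE RDB G : finType)
    (d : market_data R N CNE RDB G) :
  [set xy.1 | xy in InitSP d] = SP d.
Proof.
apply/seteqP; split=> x.
  by move=> [[x' y] F <-]; exact: InitSP_sub_SP F.
by move=> /SP_sub_InitSP[y F]; exists (x, y).
Qed.
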